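(* The model category $\mathcal E$ of partitioned sets is proper; that is, in $\mathcal E$ the pushout of an acyclic map along a cofibration is acyclic, and the pullback of an acyclic map along a fibration is acyclic.
   Context: A partitioned set is a set $X$ with an equivalence relation $\sim$. A morphism $f:X\to Y$ of partitioned sets is a map of sets with $f(x)\sim f(x')$ whenever $x\sim x'$. $\mathcal E$ is the category of partitioned sets and their morphisms. It is a model category in which a morphism $f:X\to Y$ is: a cofibration if it is injective; a fibration if it maps each equivalence class of $X$ onto an equivalence class of $Y$; a weak equivalence (also called acyclic) if the induced map of quotient sets $X/\!\sim\;\to Y/\!\sim$ is a bijection. *)

(* Defs.v *)
(* MathComp, with the classical sets of MathComp-Analysis. *)
From mathcomp Require Import all_boot.
From mathcomp Require Import boolp classical_sets.
From Corelib Require Import RelationClasses.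

Set Implicit Arguments.
Unset Strict Implicit.
Unset Printing Implicit Defensive.

Local Open Scope classical_set_scope.

Record category := Category {
  obj :> Type;
  hom : obj -> obj -> Type;
  idc : forall X : obj, hom X X;
  compc : forall X Y Z : obj, hom Y Z -> hom X Y -> hom X Z;
  comp1c : forall (X Y : obj) (f : hom X Y), compc (idc Y) f = f;
  compc1 : forall (X Y : obj) (f : hom X Y), compc f (idc X) = f;
  compcA : forall (X Y Z T : obj) (h : hom Z T) (g : hom Y Z) (f : hom X Y),
    compc h (compc g f) = compc (compc h g) f }.

Arguments hom {c} X Y.
Arguments idc {c} X.
Arguments compc {c X Y Z} g f.

Notation "g '\oc' f" := (compc g f) (at level 50, left associativity).

(*      X --i--> Z
        |        |
        f        g
        v        v
        Y --j--> P     g is the pushout of f along i *)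
Definition is_pushout (C : category) (X Y Z P : C)
    (f : hom X Y) (i : hom X Z) (j : hom Y P) (g : hom Z P) : Prop :=
  j \oc f = g \oc i /\
  forall (T : C) (u : hom Y T) (v : hom Z T), u \oc f = v \oc i ->
    exists! w : hom P T, w \oc j = u /\ w \oc g = v.

(*      P --q--> X
        |        |
        g        f
        v        v
        Z --p--> Y     g is the pullback of f along p *)
Definition is_pullback (C : category) (X Y Z P : C)
    (f : hom X Y) (p : hom Z Y) (q : hom P X) (g : hom P Z) : Prop :=
  f \oc q = p \oc g /\
  forall (T : C) (u : hom T X) (v : hom T Z), f \oc u = p \oc v ->
    exists! w : hom T P, q \oc w = u /\ g \oc w = v.

Definition hom_class (C : category) := forall X Y : C, hom X Y -> Prop.

Definition left_proper (C : category) (weq cof : hom_class C) : Prop :=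
  forall (X Y Z P : C)
    (f : hom X Y) (i : hom X Z) (j : hom Y P) (g : hom Z P),
  is_pushout f i j g -> weq X Y f -> cof X Z i -> weq Z P g.

Definition right_proper (C : category) (weq fib : hom_class C) : Prop :=
  forall (X Y Z P : C)
    (f : hom X Y) (p : hom Z Y) (q : hom P X) (g : hom P Z),
  is_pullback f p q g -> weq X Y f -> fib Z Y p -> weq P Z g.

Definition is_proper (C : category) (weq cof fib : hom_class C) : Prop :=
  left_proper weq cof /\ right_proper weq fib.

Record pset := PSet {
  pset_carrier :> Type;
  peq : pset_carrier -> pset_carrier -> Prop;
  peq_equiv : Equivalence peq }.

Arguments peq {p} x y.

Notation "x '~~~' y" := (peq x y) (at level 70, no associativity).

Record phom (X Y : pset) := PHom {
  pfun :> X -> Y;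
  pfun_peq : forall x x' : X, x ~~~ x' -> pfun x ~~~ pfun x' }.

Lemma phomP (X Y : pset) (f g : phom X Y) : pfun f =1 pfun g -> f = g.
Proof.
case: f => f fP; case: g => g gP /= /funext fg; case: _ / fg gP => gP.
by rewrite (Prop_irrelevance fP gP).
Qed.

Definition pid (X : pset) : phom X X := PHom (fun x x' (h : x ~~~ x') => h).

Definition pcomp (X Y Z : pset) (g : phom Y Z) (f : phom X Y) : phom X Z :=
  PHom (fun x x' (h : x ~~~ x') => pfun_peq g (pfun_peq f h)).

Lemma pcomp1p (X Y : pset) (f : phom X Y) : pcomp (pid Y) f = f.
Proof. exact: phomP. Qed.

Lemma pcompp1 (X Y : pset) (f : phom X Y) : pcomp f (pid X) = f.
Proof. exact: phomP. Qed.

Lemma pcompA (X Y Z T : pset) (h : phom Z T) (g : phom Y Z) (f : phom X Y) :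
  pcomp h (pcomp g f) = pcomp (pcomp h g) f.
Proof. exact: phomP. Qed.

Definition PSetCat : category :=
  @Category pset phom pid pcomp pcomp1p pcompp1 pcompA.

Definition pclass (X : pset) (x : X) : set X := [set x' | x ~~~ x'].

Definition is_pclass (X : pset) (A : set X) : Prop :=
  exists x : X, A = pclass x.

(* The quotient set X / ~, as the type of equivalence classes. *)
Definition pquot (X : pset) : Type := {A : set X | is_pclass A}.

Definition pproj (X : pset) (x : X) : pquot X :=
  exist _ (pclass x) (ex_intro _ x erefl).

(* f sends a class A to the class of Y containing f @` A. *)
Definition class_map (X Y : pset) (f : phom X Y) (A : set X) : set Y :=
  [set y | exists2 x, A x & f x ~~~ y].

Lemma class_map_pclass (X Y : pset) (f : phom X Y) (x : X) :
  class_map f (pclass x) = pclass (f x).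
Proof.
have [_ _ tY] := peq_equiv Y; have [rX _ _] := peq_equiv X.
apply/seteqP; split=> y.
- by case=> x' xx' fx'y; apply: (tY _ (f x')) => //; apply: pfun_peq.
- by move=> fxy; exists x => //; apply: rX.
Qed.

Lemma is_pclass_map (X Y : pset) (f : phom X Y) (A : set X) :
  is_pclass A -> is_pclass (class_map f A).
Proof. by case=> x ->; exists (f x); apply: class_map_pclass. Qed.

Definition quot_map (X Y : pset) (f : phom X Y) (a : pquot X) : pquot Y :=
  exist _ (class_map f (sval a)) (is_pclass_map f (svalP a)).

Lemma quot_map_pproj (X Y : pset) (f : phom X Y) (x : X) :
  quot_map f (pproj x) = pproj (f x).
Proof. by apply: eq_exist; apply: class_map_pclass. Qed.

Definition cofibration : hom_class PSetCat :=
  fun (X Y : pset) (f : phom X Y) => injective f.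

Definition fibration : hom_class PSetCat :=
  fun (X Y : pset) (f : phom X Y) =>
    forall A : set X, is_pclass A -> is_pclass (f @` A).

Definition acyclic : hom_class PSetCat :=
  fun (X Y : pset) (f : phom X Y) => bijective (quot_map f).

(* Main.v *)
(* The quotient functor X |-> X/~ is left adjoint to the functor sending a set
   to the same set with the equality relation, so it preserves pushouts;
   since bijections are stable under pushout, so are acyclic maps, along any
   map at all.  For pullbacks, the equivalence on P is the one jointly induced
   by q and g, and if f x ~ p z then, p being a fibration, z can be moved
   within its class to some z' with p z' = f x, which lifts to P. *)
From mathcomp Require Import all_boot.
From mathcomp Require Import boolp classical_sets.
From Corelib Require Import RelationClasses.
Require Import Defs.

Set Implicit Arguments.
Unset Strict Implicit.
Unset Printing Implicit Defensive.

Local Open Scope classical_set_scope.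

Lemma peq_refl (X : pset) (x : X) : x ~~~ x.
Proof. by have [rX _ _] := peq_equiv X; apply: rX. Qed.

Lemma peq_sym (X : pset) (x y : X) : x ~~~ y -> y ~~~ x.
Proof. by have [_ sX _] := peq_equiv X; apply: sX. Qed.

Lemma peq_trans (X : pset) (x y z : X) : x ~~~ y -> y ~~~ z -> x ~~~ z.
Proof. by have [_ _ tX] := peq_equiv X; apply: tX. Qed.

Lemma eq_pfun (X Y : pset) (f g : phom X Y) : f = g -> pfun f =1 pfun g.
Proof. by move->. Qed.

Lemma pproj_eq (X : pset) (x x' : X) : pproj x = pproj x' <-> x ~~~ x'.
Proof.
split=> [/(congr1 sval) /= exx' | xx'].
  have : pclass x' x' by apply: peq_refl.
  by rewrite -exx'.
apply: eq_exist; apply/seteqP; split=> y /=; first exact/peq_trans/peq_sym.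
exact: peq_trans.
Qed.

Lemma pproj_surj (X : pset) (a : pquot X) : exists x, pproj x = a.
Proof. by case: a => A [x eA]; exists x; apply: eq_exist. Qed.

(** Two classes are equal exactly when their representatives are equivalent, so bijectivity on
    quotients can be tested on elements. This avoids handling classes in the rest of the proof. *)
Lemma acyclicP (X Y : pset) (f : phom X Y) :
  acyclic f <-> (forall x x', f x ~~~ f x' -> x ~~~ x') /\
                (forall y, exists x, f x ~~~ y).
Proof.
split=> [[h fK hK] | [f_inj f_surj]].
  split=> [x x' fxx' | y].
    apply/pproj_eq/(can_inj fK); rewrite !quot_map_pproj; exact/pproj_eq.
  have [x hx] := pproj_surj (h (pproj y)).
  by exists x; apply/pproj_eq; rewrite -quot_map_pproj hx hK.
have qsurj (b : pquot Y) : exists a, quot_map f a = b.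
  have [y <-] := pproj_surj b; have [x fxy] := f_surj y.
  by exists (pproj x); rewrite quot_map_pproj; apply/pproj_eq.
(* A chosen section [h] of [quot_map f] is also a left inverse, because [f] reflects equivalence. *)
have [h hK] := choice qsurj; exists h => // a.
have [x hx] := pproj_surj (h (quot_map f a)); have [x' hx'] := pproj_surj a.
have := hK (quot_map f a).
by rewrite -hx -hx' !quot_map_pproj => /pproj_eq/f_inj/pproj_eq.
Qed.

Definition discrete (S : Type) : pset := PSet (@eq_equivalence S).

Definition disc_hom (X : pset) (S : Type) (h : X -> S)
    (hP : forall x x', x ~~~ x' -> h x = h x') : phom X (discrete S) :=
  @PHom X (discrete S) h hP.

Lemma pushout_acyclic (X Y Z P : pset)
    (f : phom X Y) (i : phom X Z) (j : phom Y P) (g : phom Z P) :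
  @is_pushout PSetCat X Y Z P f i j g -> acyclic f -> acyclic g.
Proof.
case=> jf_gi univ /acyclicP[f_inj f_surj].
have jfE x : j (f x) = g (i x) by exact: eq_pfun jf_gi x.
apply/acyclicP; split.
  (* The universal property is tested on the discrete set of classes of [Z]: [v] is the projection
     and [u] sends [y] to the class of [i (s y)], where [f (s y) ~~~ y]. The induced [w] recovers
     the class of [z] from [g z]. *)
  have [s sP] := choice f_surj.
  have uP y y' : y ~~~ y' -> pproj (i (s y)) = pproj (i (s y')).
    move=> yy'; apply/pproj_eq/pfun_peq/f_inj.
    exact: peq_trans (sP y) (peq_trans yy' (peq_sym (sP y'))).
  pose u := disc_hom uP.
  pose v := disc_hom (fun z z' : Z => (pproj_eq z z').2).
  have [|w [[_ wg] _]] := univ (discrete (pquot Z)) u v.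
    apply: phomP => x /=; apply/pproj_eq/pfun_peq/f_inj; exact: sP.
  have wgE z : w (g z) = pproj z by exact: eq_pfun wg z.
  by move=> z z' /(pfun_peq w) gzz'; apply/pproj_eq; rewrite -!wgE.
(* Surjectivity on classes: the predicate of being equivalent to a value of [g] is a map from [P] to
   discrete [Prop]. It agrees with the constant [True] after [j] and after [g], so uniqueness makes
   it [True] everywhere. *)
have imP p p' : p ~~~ p' -> (exists z, g z ~~~ p) = (exists z, g z ~~~ p').
  move=> pp'; apply/propext; split=> -[z gz]; exists z; apply: peq_trans gz _ => //.
  exact: peq_sym.
pose w := disc_hom imP.
pose t := disc_hom (fun (p p' : P) (_ : p ~~~ p') => erefl True).
have [|w0 [_ w0_uniq]] := univ (discrete Prop) (pcomp t j) (pcomp t g).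
  exact: phomP.
have tw : t = w.
  transitivity w0; first by symmetry; apply: w0_uniq.
  apply: w0_uniq; split; apply: phomP => /= a; apply/propext; split=> // _.
    by have [x fxa] := f_surj a; exists (i x); rewrite -jfE; apply: pfun_peq.
  by exists a; apply: peq_refl.
by move=> p; rewrite -[exists z, _]/(w p) -tw.
Qed.

(** The set [P] with the relation induced by [q] and [g] is again a cone, so it maps to [P] over [X]
    and [Z]. This map is the identity on elements, hence the induced relation implies that of
    [P]. *)
Lemma pullback_peq (X Y Z P : pset)
    (f : phom X Y) (p : phom Z Y) (q : phom P X) (g : phom P Z) (a b : P) :
  @is_pullback PSetCat X Y Z P f p q g ->
  q a ~~~ q b -> g a ~~~ g b -> a ~~~ b.
Proof.
case=> fq_pg univ qab gab.
pose r (c d : P) := q c ~~~ q d /\ g c ~~~ g d.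
have r_equiv : Equivalence r.
  split=> [c | c d [qcd gcd] | c d e [qcd gcd] [qde gde]]; split.
  - exact: peq_refl.
  - exact: peq_refl.
  - exact: peq_sym.
  - exact: peq_sym.
  - exact: peq_trans qcd qde.
  - exact: peq_trans gcd gde.
pose T := PSet r_equiv.
pose qT := @PHom T X q (fun c d => @proj1 _ _).
pose gT := @PHom T Z g (fun c d => @proj2 _ _).
pose e := @PHom P T id (fun c d cd => conj (pfun_peq q cd) (pfun_peq g cd)).
have [|w [[qw gw] _]] := univ T qT gT.
  apply: phomP => c; exact: eq_pfun fq_pg c.
have [w0 [_ w0_uniq]] := univ P q g fq_pg.
(* Both sides are endomorphisms of the pullback cone. *)
have we : pcomp w e = pid P.
  transitivity w0; last by apply: w0_uniq; split; apply: phomP.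
  symmetry; apply: w0_uniq; split; apply: phomP => c.
    exact: eq_pfun qw c.
  exact: eq_pfun gw c.
have wE c : w c = c by exact: eq_pfun we c.
by rewrite -(wE a) -(wE b); apply: pfun_peq.
Qed.

(** Elements are maps from the one-point set, to which the universal property applies. *)
Lemma pullback_lift (X Y Z P : pset)
    (f : phom X Y) (p : phom Z Y) (q : phom P X) (g : phom P Z)
    (x : X) (z : Z) :
  @is_pullback PSetCat X Y Z P f p q g -> f x = p z -> exists c, g c = z.
Proof.
case=> _ univ fxpz.
pose pt (W : pset) (t : W) : phom (discrete unit) W :=
  @PHom (discrete unit) W (fun=> t) (fun _ _ _ => peq_refl t).
have [|w [[_ gw] _]] := univ (discrete unit) (pt _ x) (pt _ z).
  exact: phomP.
by exists (w tt); exact: (eq_pfun gw tt).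
Qed.

(** The image of the class of [z] is a whole class and contains [p z], hence also [y]. *)
Lemma fibration_lift (Z Y : pset) (p : phom Z Y) (z : Z) (y : Y) :
  fibration p -> p z ~~~ y -> exists2 z', z ~~~ z' & p z' = y.
Proof.
move=> p_fib pzy; have [|y0 pE] := p_fib (pclass z); first by exists z.
suff : (p @` pclass z) y by case=> z'; exists z'.
have : (p @` pclass z) (p z) by exists z => //; apply: peq_refl.
by rewrite pE => y0pz; apply: peq_trans pzy.
Qed.

Lemma pullback_acyclic (X Y Z P : pset)
    (f : phom X Y) (p : phom Z Y) (q : phom P X) (g : phom P Z) :
  @is_pullback PSetCat X Y Z P f p q g -> fibration p -> acyclic f ->
  acyclic g.
Proof.
move=> pb p_fib /acyclicP[f_inj f_surj].
have fqE c : f (q c) = p (g c).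
  by case: pb => fq_pg _; exact: eq_pfun fq_pg c.
apply/acyclicP; split=> [a b gab | z].
  (* [q a ~~~ q b] holds because [f] reflects equivalence and [f (q c) = p (g c)]. *)
  apply: pullback_peq pb _ (gab); apply: f_inj; rewrite !fqE; exact: pfun_peq.
have [x fxpz] := f_surj (p z).
have [z' zz' pz'] := fibration_lift p_fib (peq_sym fxpz).
have [c gc] := pullback_lift pb (esym pz').
by exists c; rewrite gc; apply: peq_sym.
Qed.

Theorem theorem5 : @is_proper PSetCat acyclic cofibration fibration.
Proof.
split=> X Y Z P f.
  by move=> i j g po f_acy _; apply: pushout_acyclic po f_acy.
by move=> p q g pb f_acy p_fib; apply: pullback_acyclic pb p_fib f_acy.
Qed.
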